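(* Let $\mathfrak{L}$ be a left Leibniz algebra over a field $\mathbb{F}$, and let $M$ and $N$ be non-trivial irreducible $\mathfrak{L}$-bimodules. Then the following statements hold: (a) If $M$ is symmetric and $N$ is anti-symmetric, then $M\,\overline{\otimes}\,N=M\,\underline{\otimes}\,N=0$. (b) If $M$ is anti-symmetric and $N$ is symmetric, then $M\,\overline{\otimes}\,N=M\,\underline{\otimes}\,N=0$.
   Context: A left Leibniz algebra is an $\mathbb{F}$-vector space $\mathfrak{L}$ with a bilinear multiplication satisfying $x(yz)=(xy)z+y(xz)$. An $\mathfrak{L}$-bimodule is an $\mathbb{F}$-vector space $M$ with bilinear left and right $\mathfrak{L}$-actions satisfying, for all $x,y\in\mathfrak{L}$, $m\in M$: (LLM) $(xy)\cdot m=x\cdot(y\cdot m)-y\cdot(x\cdot m)$; (LML) $(x\cdot m)\cdot y=x\cdot(m\cdot y)-m\cdot(xy)$; (MLL) $(m\cdot x)\cdot y=m\cdot(xy)-x\cdot(m\cdot y)$. It is symmetric if $m\cdot x=-x\cdot m$ for all $x,m$; anti-symmetric if $m\cdot x=0$ for all $x,m$; trivial if $x\cdot m=0=m\cdot x$ for all $x,m$; irreducible if it is non-zero and has no subspaces invariant under both actions other than $0$ and itself. For $\mathfrak{L}$-bimodules $M,N$, the space $M\otimes N$ (over $\mathbb{F}$) carries the actions $x\cdot(m\otimes n):=(x\cdot m)\otimes n+m\otimes(x\cdot n)$ and $(m\otimes n)\cdot x:=(m\cdot x)\otimes n+m\otimes(n\cdot x)$. Let $T(M,N)$ be the smallest subspace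 of $M\otimes N$ that is closed under these left and right actions and contains $$S(M,N):=\{(x\cdot m+m\cdot x)\otimes(n\cdot y)+(m\cdot y)\otimes(x\cdot n+n\cdot x)\mid x,y\in\mathfrak{L},\ m\in M,\ n\in N\}.$$ Put $M_0:=\langle x\cdot m+m\cdot x\mid x\in\mathfrak{L},m\in M\rangle_{\mathbb{F}}$, $M\mathfrak{L}:=\langle m\cdot x\mid m\in M,x\in\mathfrak{L}\rangle_{\mathbb{F}}$ (similarly for $N$), and $T_0(M,N):=M_0\otimes N\mathfrak{L}+M\mathfrak{L}\otimes N_0\subseteq M\otimes N$. Define $M\,\overline{\otimes}\,N:=(M\otimes N)/T(M,N)$ and $M\,\underline{\otimes}\,N:=(M\otimes N)/T_0(M,N)$, with the induced actions. *)

(* Defs.v *)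
From HB Require Import structures.
From mathcomp Require Import all_boot all_order all_algebra.
From mathcomp Require Import generic_quotient ring_quotient freeg.
From mathcomp Require Import boolp classical_sets.

Set Implicit Arguments.
Unset Strict Implicit.
Unset Printing Implicit Defensive.

Import GRing.Theory.
Local Open Scope ring_scope.
Local Open Scope classical_set_scope.
Local Open Scope quotient_scope.

(* Lets a subspace U be applied: U v stands for membership of v in U. *)
Identity Coercion fun_of_set : set >-> Funclass.

Record subspace (F : fieldType) (V : lmodType F) := Subspace {
  subspace_set :> set V;
  subspaceP : submod_closed (mem subspace_set) }.

Section Subspaces.
Variables (F : fieldType) (V : lmodType F).
Implicit Types (U : subspace V) (A : set V).

Lemma submod_closed_set A :
  A 0 -> (forall a u v, A u -> A v -> A (a *: u + v)) -> submod_closed (mem A).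
Proof.
move=> A0 AD; split; first exact/mem_set.
by move=> a u v /set_mem Au /set_mem Av; apply/mem_set/AD.
Qed.

Lemma subspace0 U : U 0.
Proof. by apply: set_mem; case: (subspaceP U). Qed.

Lemma subspaceD U a u v : U u -> U v -> U (a *: u + v).
Proof.
move=> Uu Uv; apply: set_mem; case: (subspaceP U) => _; apply; exact/mem_set.
Qed.

Lemma subspaceA U u v : U u -> U v -> U (u + v).
Proof. by move=> /(@subspaceD U 1 u v) UD /UD; rewrite scale1r. Qed.

Lemma subspaceB U u v : U u -> U v -> U (u - v).
Proof. by move=> Uu Uv; rewrite addrC -scaleN1r; apply: subspaceD. Qed.

Lemma subspaceZ U a u : U u -> U (a *: u).
Proof. by move=> Uu; rewrite -[_ *: _]addr0; apply/subspaceD/subspace0. Qed.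

Lemma lspan_subproof A :
  submod_closed (mem (smallest (fun B : set V => submod_closed (mem B)) A)).
Proof.
apply: submod_closed_set => [U [Ucl _]|a u v Au Av U [Ucl AU]].
  exact: (@subspace0 (Subspace Ucl)).
by apply: (@subspaceD (Subspace Ucl)); [apply: Au|apply: Av].
Qed.

Definition lspan A : subspace V := Subspace (lspan_subproof A).

Lemma sub_lspan A : A `<=` lspan A.
Proof. exact: sub_gen_smallest. Qed.

Lemma lspan_sub A U : A `<=` U -> lspan A `<=` U.
Proof. exact: smallest_sub (subspaceP U). Qed.

Lemma addsub_subproof (U1 U2 : subspace V) :
  submod_closed (mem [set u1 + u2 | u1 in U1 & u2 in U2]).
Proof.
apply: submod_closed_set.
  by exists 0; [exact: subspace0|exists 0; [exact: subspace0|rewrite addr0]].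
move=> a _ _ [u1 U1u [u2 U2u <-]] [v1 U1v [v2 U2v <-]].
exists (a *: u1 + v1); first exact: subspaceD.
exists (a *: u2 + v2); first exact: subspaceD.
by rewrite scalerDr addrACA.
Qed.

Definition addsub (U1 U2 : subspace V) : subspace V :=
  Subspace (addsub_subproof U1 U2).

Definition subspace_pred U : {pred V} := mem (subspace_set U).

HB.instance Definition _ U :=
  GRing.isSubmodClosed.Build F V (subspace_pred U) (subspaceP U).

End Subspaces.

Section Preimage.
Variables (F : fieldType) (V W : lmodType F).

Lemma preim_subproof (f : {linear V -> W}) (U : subspace W) :
  submod_closed (mem (f @^-1` U)).
Proof.
apply: submod_closed_set => [|a u v] /=; first by rewrite linear0; exact: subspace0.
by move=> Uu Uv; rewrite linearP; apply: subspaceD.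
Qed.

Lemma lspan_preim (f : {linear V -> W}) (U : subspace W) (A : set V) :
  (forall v, A v -> U (f v)) -> forall v, lspan A v -> U (f v).
Proof. by move=> AU; apply: (lspan_sub (U := Subspace (preim_subproof f U))). Qed.

End Preimage.

Section QuotientSpace.
Variables (F : fieldType) (V : lmodType F) (U : subspace V).

Definition quotient := Quotient.quot (subspace_pred U).

HB.instance Definition _ := GRing.Zmodule.on quotient.

Definition quotient_proj (v : V) : quotient := \pi_(quotient) v.

Lemma quotient_projP u v : quotient_proj u = quotient_proj v <-> U (u - v).
Proof.
split=> [/eqP|Uuv]; last first.
  by apply/eqP; rewrite -Quotient.idealrBE; apply/mem_set.
by rewrite -Quotient.idealrBE => /set_mem.
Qed.

Lemma quotient_reprK (q : quotient) : quotient_proj (repr q) = q.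
Proof. exact: reprK. Qed.

Lemma quotient_projB : zmod_morphism quotient_proj.
Proof. exact: pi_is_zmod_morphism. Qed.

HB.instance Definition _ :=
  GRing.isZmodMorphism.Build V quotient quotient_proj quotient_projB.

Definition quotient_scale a (q : quotient) : quotient :=
  quotient_proj (a *: repr q).

Lemma quotient_projZ a v :
  quotient_proj (a *: v) = quotient_scale a (quotient_proj v).
Proof.
apply/quotient_projP; rewrite -scalerBr; apply: subspaceZ.
by apply/quotient_projP; rewrite quotient_reprK.
Qed.

Lemma quotient_scaleA a b q :
  quotient_scale a (quotient_scale b q) = quotient_scale (a * b) q.
Proof. by rewrite -[q]quotient_reprK -!quotient_projZ scalerA. Qed.

Lemma quotient_scale1 : left_id 1 quotient_scale.
Proof. by move=> q; rewrite -[q]quotient_reprK -!quotient_projZ scale1r. Qed.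

Lemma quotient_scaleDr : right_distributive quotient_scale +%R.
Proof.
move=> a p q; rewrite -[p]quotient_reprK -[q]quotient_reprK.
by rewrite -!quotient_projZ -!(raddfD quotient_proj) -!quotient_projZ scalerDr.
Qed.

Lemma quotient_scaleDl q : {morph quotient_scale^~ q : a b / a + b}.
Proof.
move=> a b; rewrite -[q]quotient_reprK -!quotient_projZ.
by rewrite -!raddfD scalerDl.
Qed.

HB.instance Definition _ := GRing.Zmodule_isLmodule.Build F quotient
  quotient_scaleA quotient_scale1 quotient_scaleDr quotient_scaleDl.

HB.instance Definition _ :=
  GRing.isScalable.Build F V quotient *:%R quotient_proj quotient_projZ.

Lemma quotient_ind (P : quotient -> Prop) :
  (forall v, P (quotient_proj v)) -> forall q, P q.
Proof. by move=> Pv q; rewrite -[q]quotient_reprK. Qed.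

Section Lift.
Variables (W : lmodType F) (f : {linear V -> W}).

Definition quotient_lift (q : quotient) : W := f (repr q).

Hypothesis f0 : forall u, U u -> f u = 0.

Lemma quotient_liftE v : quotient_lift (quotient_proj v) = f v.
Proof.
apply/eqP; rewrite -subr_eq0 -linearB; apply/eqP/f0.
by apply/quotient_projP; rewrite quotient_reprK.
Qed.

Lemma quotient_lift_linear : linear quotient_lift.
Proof.
move=> a; elim/quotient_ind=> u; elim/quotient_ind=> v.
by rewrite -linearP !quotient_liftE linearP.
Qed.

End Lift.
End QuotientSpace.

Lemma fglift_linear (F : fieldType) (K : choiceType) (P : lmodType F)
  (f : K -> P) : linear (fglift f).
Proof.
have fgB := lift_is_additive f.
pose fA := GRing.isZmodMorphism.Build _ _ (fglift f) fgB.
pose g : {additive _ -> _} := HB.pack (fglift f) fA.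
have gZ a D : g (a *: D) = a *: g D.
  rewrite -[D in RHS]freeg_sumE [a *: D]/(fgscale a D) /fgscale !raddf_sum.
  apply: eq_bigr => x _ /=.
  by rewrite !liftU scalerA.
by move=> a u v; rewrite -[fglift f]/(g : _ -> _) raddfD gZ.
Qed.

HB.instance Definition _ (F : fieldType) (K : choiceType) (P : lmodType F)
    (f : K -> P) :=
  GRing.isLinear.Build F {freeg K / F} P *:%R (fglift f) (fglift_linear f).

(* The free vector space on V * W modulo the bilinearity relations. *)
Section Tensor.
Variables (F : fieldType) (V W : lmodType F).

Local Notation free := {freeg (V * W)%type / F}.
Local Notation "<< v , w >>" := (Freeg [:: (1 : F, (v, w))] : free).

Definition tensor_relations : set free :=
  [set t | exists a v v' w,
     t = << a *: v + v', w >> - (a *: << v, w >> + << v', w >>)] `|`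
  [set t | exists a v w w',
     t = << v, a *: w + w' >> - (a *: << v, w >> + << v, w' >>)].

Definition tensor := quotient (lspan tensor_relations).

HB.instance Definition _ := GRing.Lmodule.on tensor.

Definition tens (v : V) (w : W) : tensor :=
  quotient_proj (lspan tensor_relations) << v, w >>.

Lemma tens_linearl w : linear (tens^~ w).
Proof.
move=> a v v'; rewrite /tens -linearP; apply/quotient_projP; apply: sub_lspan.
by left; exists a, v, v', w.
Qed.

Lemma tens_linearr v : linear (tens v).
Proof.
move=> a w w'; rewrite /tens -linearP; apply/quotient_projP; apply: sub_lspan.
by right; exists a, v, w, w'.
Qed.

Lemma tensor_ind (P : tensor -> Prop) :
    P 0 -> (forall a t u, P t -> P u -> P (a *: t + u)) ->
  (forall v w, P (tens v w)) -> forall t, P t.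
Proof.
move=> P0 PD Pt; elim/quotient_ind=> D; rewrite -[D]freeg_sumE linear_sum.
elim/big_ind: _ => // [x y Px Py|[v w] _]; first by rewrite -[x]scale1r; apply: PD.
have -> : Freeg [:: (coeff (v, w) D, (v, w))] = coeff (v, w) D *: << v, w >>.
  by apply/eqP/freeg_eqP => k; rewrite coeffZ !coeffU mul1r.
by rewrite linearZ_LR -[_ *: _]addr0; apply: PD (Pt v w) P0.
Qed.

Section Lift.
Variables (P : lmodType F) (f : V -> W -> P).

Definition tensor_lift : tensor -> P :=
  @quotient_lift F free (lspan tensor_relations) P (fglift (fun p => f p.1 p.2)).

Hypotheses (fl : forall w, linear (f^~ w)) (fr : forall v, linear (f v)).

Lemma tensor_relations0 t :
  lspan tensor_relations t -> fglift (fun p => f p.1 p.2) t = 0.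
Proof.
have S0 : submod_closed (mem [set 0 : P]).
  by apply: submod_closed_set => [//|a u v -> ->] /=; rewrite scaler0 addr0.
apply: (@lspan_preim _ _ _ (fglift (fun p => f p.1 p.2)) (Subspace S0)) => {t}.
by move=> t [[a [v [v' [w ->]]]]|[a [v [w [w' ->]]]]] /=;
  rewrite linearB linearP /= !liftU !scale1r /= ?fl ?fr subrr.
Qed.

Lemma tensor_liftE v w : tensor_lift (tens v w) = f v w.
Proof.
rewrite /tensor_lift quotient_liftE /= ?liftU ?scale1r //.
exact: tensor_relations0.
Qed.

Lemma tensor_lift_linear : linear tensor_lift.
Proof. exact/quotient_lift_linear/tensor_relations0. Qed.

End Lift.
End Tensor.

HB.mixin Record Lmodule_isLeibniz (F : fieldType) L of GRing.Lmodule F L := {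
  lmul : L -> L -> L;
  lmul_linearl : forall y, linear (lmul^~ y);
  lmul_linearr : forall x, linear (lmul x);
  lmul_leibniz : forall x y z,
    lmul x (lmul y z) = lmul (lmul x y) z + lmul y (lmul x z) }.

#[short(type="leibnizType")]
HB.structure Definition Leibniz (F : fieldType) :=
  {L of Lmodule_isLeibniz F L & GRing.Lmodule F L}.

(* Bilinear left and right actions, without any compatibility condition: the
   actions on M (x) N do not make it a bimodule in general. *)
HB.mixin Record Lmodule_isBiact (F : fieldType) (L : leibnizType F) M
    of GRing.Lmodule F M := {
  lact : L -> M -> M;
  ract : M -> L -> M;
  lact_linearl : forall m, linear (lact^~ m);
  lact_linearr : forall x, linear (lact x);
  ract_linearl : forall x, linear (ract^~ x);
  ract_linearr : forall m, linear (ract m) }.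

#[short(type="biactType")]
HB.structure Definition Biact (F : fieldType) (L : leibnizType F) :=
  {M of Lmodule_isBiact F L M & GRing.Lmodule F M}.

HB.mixin Record Biact_isBimodule (F : fieldType) (L : leibnizType F) M
    of Biact F L M := {
  LLM : forall (x y : L) (m : M),
    lact (lmul x y) m = lact x (lact y m) - lact y (lact x m);
  LML : forall (x y : L) (m : M),
    ract (lact x m) y = lact x (ract m y) - ract m (lmul x y);
  MLL : forall (x y : L) (m : M),
    ract (ract m x) y = ract m (lmul x y) - lact x (ract m y) }.

#[short(type="bimodType")]
HB.structure Definition Bimodule (F : fieldType) (L : leibnizType F) :=
  {M of Biact_isBimodule F L M & Biact F L M}.

HB.instance Definition _ (F : fieldType) (L : leibnizType F) (M : biactType L)
    (x : L) :=
  GRing.isLinear.Build F M M *:%R (lact x : M -> M) (lact_linearr x).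

HB.instance Definition _ (F : fieldType) (L : leibnizType F) (M : biactType L)
    (m : M) :=
  GRing.isLinear.Build F L M *:%R (ract m : L -> M) (ract_linearr m).

(* [ract^~ x] as a keyed constant, so that its linearity can be inferred. *)
Definition ract_by (F : fieldType) (L : leibnizType F) (M : biactType L)
  (x : L) (m : M) : M := ract m x.

HB.instance Definition _ (F : fieldType) (L : leibnizType F) (M : biactType L)
    (x : L) :=
  GRing.isLinear.Build F M M *:%R (@ract_by F L M x) (ract_linearl x).

Section BimoduleProperties.
Variables (F : fieldType) (L : leibnizType F) (M : biactType L).

Definition action_closed (U : set M) : Prop :=
  forall (x : L) (m : M), U m -> U (lact x m) /\ U (ract m x).

Record subbiact := Subbiact {
  subbiact_space :> subspace M;
  subbiactP : action_closed subbiact_space }.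

Definition symmetric_bimod : Prop := forall (x : L) (m : M), ract m x = - lact x m.

Definition antisymmetric_bimod : Prop := forall (x : L) (m : M), ract m x = 0.

Definition trivial_bimod : Prop :=
  forall (x : L) (m : M), lact x m = 0 /\ ract m x = 0.

Definition irreducible_bimod : Prop :=
  (exists m : M, m != 0) /\
  forall U : subbiact, U = [set 0] :> set M \/ U = [set: M] :> set M.

(* M_0 *)
Definition sym_kernel : subspace M :=
  lspan [set v | exists (x : L) (m : M), v = lact x m + ract m x].

(* ML *)
Definition ract_image : subspace M :=
  lspan [set v | exists (m : M) (x : L), v = ract m x].

End BimoduleProperties.

Arguments symmetric_bimod {F L} M.
Arguments antisymmetric_bimod {F L} M.
Arguments trivial_bimod {F L} M.
Arguments irreducible_bimod {F L} M.
Arguments sym_kernel {F L} M.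
Arguments ract_image {F L} M.

Section GeneratedSubbiact.
Variables (F : fieldType) (L : leibnizType F) (M : biactType L) (A : set M).

Let closed (B : set M) := submod_closed (mem B) /\ action_closed B.

Lemma gen_subproof : submod_closed (mem (smallest closed A)).
Proof.
apply: submod_closed_set => [U [[Ucl _] _]|a u v Au Av U [[Ucl Uact] AU]].
  exact: (@subspace0 _ _ (Subspace Ucl)).
by apply: (@subspaceD _ _ (Subspace Ucl)); [apply: Au|apply: Av].
Qed.

Lemma gen_action_subproof : action_closed (Subspace gen_subproof).
Proof.
move=> x m Am; split=> U [[Ucl Uact] AU].
  by case: (Uact x m (Am U _)).
by case: (Uact x m (Am U _)).
Qed.

Definition gen_subbiact : subbiact M := Subbiact gen_action_subproof.

End GeneratedSubbiact.

Section QuotientBiact.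
Variables (F : fieldType) (L : leibnizType F) (M : biactType L) (U : subbiact M).

Definition biact_quotient : Type := quotient U.

HB.instance Definition _ := GRing.Lmodule.on biact_quotient.

Definition quotient_lact (x : L) : biact_quotient -> biact_quotient :=
  quotient_lift (quotient_proj U \o lact x).

Definition quotient_ract (q : biact_quotient) (x : L) : biact_quotient :=
  quotient_lift (quotient_proj U \o ract_by x) q.

Lemma quotient_lactE x m :
  quotient_lact x (quotient_proj U m) = quotient_proj U (lact x m).
Proof.
apply: quotient_liftE => u Uu /=; rewrite -(linear0 (quotient_proj U)).
by apply/quotient_projP; rewrite subr0; case: (subbiactP x Uu).
Qed.

Lemma quotient_ractE m x :
  quotient_ract (quotient_proj U m) x = quotient_proj U (ract m x).
Proof.
apply: quotient_liftE => u Uu /=; rewrite -(linear0 (quotient_proj U)).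
by apply/quotient_projP; rewrite subr0; case: (subbiactP x Uu).
Qed.

Lemma quotient_lact_linearl q : linear (quotient_lact^~ q).
Proof.
elim/quotient_ind: q => m a x y.
by rewrite !quotient_lactE lact_linearl linearP.
Qed.

Lemma quotient_lact_linearr x : linear (quotient_lact x).
Proof.
move=> a; elim/quotient_ind=> m; elim/quotient_ind=> n.
by rewrite -linearP !quotient_lactE linearP linearP.
Qed.

Lemma quotient_ract_linearl x : linear (quotient_ract^~ x).
Proof.
move=> a; elim/quotient_ind=> m; elim/quotient_ind=> n.
by rewrite -linearP !quotient_ractE ract_linearl linearP.
Qed.

Lemma quotient_ract_linearr q : linear (quotient_ract q).
Proof.
elim/quotient_ind: q => m a x y.
by rewrite !quotient_ractE linearP linearP.
Qed.

HB.instance Definition _ := Lmodule_isBiact.Build F L biact_quotient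
  quotient_lact_linearl quotient_lact_linearr
  quotient_ract_linearl quotient_ract_linearr.

End QuotientBiact.

Section TensorBiact.
Variables (F : fieldType) (L : leibnizType F) (M N : biactType L).

Definition biact_tensor : Type := tensor M N.

HB.instance Definition _ := GRing.Lmodule.on biact_tensor.

Definition tensor_lact (x : L) : biact_tensor -> biact_tensor :=
  tensor_lift (fun (m : M) (n : N) => tens (lact x m) n + tens m (lact x n)).

Definition tensor_ract (t : biact_tensor) (x : L) : biact_tensor :=
  tensor_lift (fun (m : M) (n : N) => tens (ract m x) n + tens m (ract n x)) t.

Lemma tensor_lact_bilin x :
  (forall n : N, linear (fun m : M => tens (lact x m) n + tens m (lact x n))) *
  (forall m : M, linear (fun n : N => tens (lact x m) n + tens m (lact x n))).
Proof.
split=> [n|m] a u v.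
  by rewrite linearP !tens_linearl scalerDr addrACA.
by rewrite linearP !tens_linearr scalerDr addrACA.
Qed.

Lemma tensor_ract_bilin x :
  (forall n : N, linear (fun m : M => tens (ract m x) n + tens m (ract n x))) *
  (forall m : M, linear (fun n : N => tens (ract m x) n + tens m (ract n x))).
Proof.
split=> [n|m] a u v.
  by rewrite ract_linearl !tens_linearl scalerDr addrACA.
by rewrite ract_linearl !tens_linearr scalerDr addrACA.
Qed.

Lemma tensor_lactE x m n :
  tensor_lact x (tens m n) = tens (lact x m) n + tens m (lact x n).
Proof. by have [? ?] := tensor_lact_bilin x; rewrite /tensor_lact tensor_liftE. Qed.

Lemma tensor_ractE m n x :
  tensor_ract (tens m n) x = tens (ract m x) n + tens m (ract n x).
Proof. by have [? ?] := tensor_ract_bilin x; rewrite /tensor_ract tensor_liftE. Qed.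

Lemma tensor_lact_linearr x : linear (tensor_lact x).
Proof. by have [? ?] := tensor_lact_bilin x; apply: tensor_lift_linear. Qed.

Lemma tensor_ract_linearl x : linear (tensor_ract^~ x).
Proof. by have [? ?] := tensor_ract_bilin x; apply: tensor_lift_linear. Qed.

Lemma linear_fun0 (V W : lmodType F) (f : V -> W) : linear f -> f 0 = 0.
Proof.
by move=> fl; have := fl (-1) 0 0; rewrite scaler0 addr0 scaleN1r addNr.
Qed.

Lemma tensor_lact_linearl t : linear (tensor_lact^~ t).
Proof.
move=> a x y; elim/tensor_ind: t => [|b t u IHt IHu|m n].
- by rewrite !(linear_fun0 (tensor_lact_linearr _)) scaler0 addr0.
- rewrite !tensor_lact_linearr IHt IHu !scalerDr !scalerA [b * a]mulrC.
  by rewrite addrACA.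
- rewrite !tensor_lactE !lact_linearl tens_linearl tens_linearr.
  by rewrite scalerDr addrACA.
Qed.

Lemma tensor_ract_linearr t : linear (tensor_ract t).
Proof.
move=> a x y; elim/tensor_ind: t => [|b t u IHt IHu|m n].
- by rewrite !(linear_fun0 (tensor_ract_linearl _)) scaler0 addr0.
- rewrite !tensor_ract_linearl IHt IHu !scalerDr !scalerA [b * a]mulrC.
  by rewrite addrACA.
- rewrite !tensor_ractE !linearP tens_linearl tens_linearr.
  by rewrite scalerDr addrACA.
Qed.

HB.instance Definition _ := Lmodule_isBiact.Build F L biact_tensor
  tensor_lact_linearl tensor_lact_linearr
  tensor_ract_linearl tensor_ract_linearr.

End TensorBiact.

Section SpanActionClosed.
Variables (F : fieldType) (L : leibnizType F) (M : biactType L).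

Lemma lspan_action_closed (A : set M) (U : subspace M) :
    (forall (x : L) m, A m -> U (lact x m) /\ U (ract m x)) ->
  forall (x : L) m, lspan A m -> U (lact x m) /\ U (ract m x).
Proof.
move=> AU x m Am; split.
  by apply: (lspan_preim (f := lact x)) Am => v /(AU x) [].
by apply: (lspan_preim (f := ract_by x)) Am => v /(AU x) [].
Qed.

End SpanActionClosed.

Section TruncatedTensor.
Variables (F : fieldType) (L : leibnizType F) (M N : bimodType L).

Lemma sym_kernel_closed (P : bimodType L) : action_closed (sym_kernel P).
Proof.
apply: lspan_action_closed => x v [y [m ->]]; split; last first.
  have -> : ract (lact y m + ract m y) x = 0.
    have := ract_linearl (s := P) x 1 (lact y m) (ract m y).
    by rewrite !scale1r => ->; rewrite LML MLL addrA subrK subrr.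
  exact: subspace0.
have -> : lact x (lact y m + ract m y) =
    (lact (lmul x y) m + ract m (lmul x y)) +
    (lact y (lact x m) + ract (lact x m) y).
  by rewrite raddfD /= LLM LML addrACA subrK [ract m _ + _]addrC subrK.
by apply: subspaceA; apply: sub_lspan; [exists (lmul x y), m|exists y, (lact x m)].
Qed.

Lemma ract_image_closed (P : bimodType L) : action_closed (ract_image P).
Proof.
apply: lspan_action_closed => x v [m [y ->]]; split; last first.
  by apply: sub_lspan; exists (ract m y), x.
have -> : lact x (ract m y) = ract (lact x m) y + ract m (lmul x y).
  by rewrite LML subrK.
by apply: subspaceA; apply: sub_lspan;
  [exists (lact x m), y|exists m, (lmul x y)].
Qed.

(* S(M, N); T(M, N) is the smallest action-closed subspace containing it. *)
Definition truncT_gen : set (biact_tensor M N) :=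
  [set t | exists (x y : L) (m : M) (n : N),
     t = tens (lact x m + ract m x) (ract n y)
         + tens (ract m y) (lact x n + ract n x)].

Definition truncT : subbiact (biact_tensor M N) := gen_subbiact truncT_gen.

(* The image of U (x) V in M (x) N, which is U (x) V itself over a field. *)
Definition tensor_sub (U : subspace M) (V : subspace N) :
    subspace (biact_tensor M N) :=
  lspan [set t | exists (m : M) (n : N), [/\ U m, V n & t = tens m n]].

Lemma tensor_sub_closed (U : subspace M) (V : subspace N) :
  action_closed U -> action_closed V -> action_closed (tensor_sub U V).
Proof.
move=> Ucl Vcl; apply: lspan_action_closed => x _ [m [n [Um Vn ->]]].
have [Ulm Urm] := Ucl x m Um; have [Vln Vrn] := Vcl x n Vn.
split.
  rewrite [lact _ _]tensor_lactE; apply: subspaceA; apply: sub_lspan.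
    by exists (lact x m), n.
  by exists m, (lact x n).
rewrite [ract _ _]tensor_ractE; apply: subspaceA; apply: sub_lspan.
  by exists (ract m x), n.
by exists m, (ract n x).
Qed.

Definition truncT0_space : subspace (biact_tensor M N) :=
  addsub (tensor_sub (sym_kernel M) (ract_image N))
         (tensor_sub (ract_image M) (sym_kernel N)).

Lemma truncT0_closed : action_closed truncT0_space.
Proof.
move=> x _ [u Uu [v Vv <-]].
have [Ulu Uru] :=
  tensor_sub_closed (@sym_kernel_closed M) (@ract_image_closed N) x Uu.
have [Vlv Vrv] :=
  tensor_sub_closed (@ract_image_closed M) (@sym_kernel_closed N) x Vv.
split.
  by exists (lact x u) => //; exists (lact x v) => //; rewrite raddfD.
exists (ract u x) => //; exists (ract v x) => //.
have := ract_linearl (s := biact_tensor M N) x 1 u v.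
by rewrite !scale1r => ->.
Qed.

Definition truncT0 : subbiact (biact_tensor M N) := Subbiact truncT0_closed.

Definition tensor_over : biactType L := biact_quotient truncT.

Definition tensor_under : biactType L := biact_quotient truncT0.

End TruncatedTensor.

Definition zero_space (F : fieldType) (V : lmodType F) : Prop :=
  forall v : V, v = 0.

(* Main.v *)
(* A non-trivial irreducible bimodule P satisfies P L = P if it is symmetric and
   P_0 = P if it is anti-symmetric: both are subbimodules, and if they vanish
   then P is trivial. When one of M, N is symmetric and the other one is
   anti-symmetric, S(M, N) consists of the tensors of generators of
   these two subbimodules, hence spans M (x) N. *)
Require Import Defs.
From mathcomp Require Import all_boot all_algebra.
From mathcomp Require Import classical_sets.

Import GRing.Theory.
Local Open Scope ring_scope.
Local Open Scope classical_set_scope.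

(** By bilinearity, with one factor fixed, the vectors whose tensor lies in [U] form a subspace.
    This extends the hypothesis from [B] to [lspan B], then from [A] to [lspan A]. *)
Lemma lspan_tens {F : fieldType} {V W : lmodType F} (A : set V) (B : set W)
    (U : subspace (tensor V W)) :
    (forall v w, A v -> B w -> U (tens v w)) ->
  forall v w, lspan A v -> lspan B w -> U (tens v w).
Proof.
move=> ABU v w Av Bw.
have AU v' : A v' -> U (tens v' w).
  move=> Av'.
  have Ucl : submod_closed (mem [set w' | U (tens v' w')]).
    apply: submod_closed_set => [|a u u' /= Uu Uu'].
      by rewrite /= (linear_fun0 (tens_linearr v')); exact: subspace0.
    by rewrite tens_linearr; exact: subspaceD.
  by apply: (lspan_sub (U := Subspace Ucl)) Bw => w'; exact: ABU.
have Ucl : submod_closed (mem [set v' | U (tens v' w)]).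
  apply: submod_closed_set => [|a u u' /= Uu Uu'].
    by rewrite /= (linear_fun0 (tens_linearl w)); exact: subspace0.
  by rewrite tens_linearl; exact: subspaceD.
exact: (lspan_sub (U := Subspace Ucl)) Av.
Qed.

Section FullSubbimodules.
Context {F : fieldType} {L : leibnizType F} {P : bimodType L}.
Hypotheses (ntP : ~ trivial_bimod P) (irrP : irreducible_bimod P).

Lemma symmetric_ract_image : symmetric_bimod P -> forall m, ract_image P m.
Proof.
move=> symP m.
case: irrP => _ /(_ (Subbiact (@ract_image_closed _ _ P)))[/= PL0|/= ->] //.
(* Here the submodule [ract_image P] is zero, so the right action vanishes, and by symmetry the left
   one too. *)
case: ntP => x p.
have px0 : ract p x = 0.
  suff : [set 0] (ract p x) by [].
  by rewrite -PL0; apply: sub_lspan; exists p, x.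
by split=> //; apply: oppr_inj; rewrite -symP px0 oppr0.
Qed.

Lemma antisymmetric_sym_kernel :
  antisymmetric_bimod P -> forall m, sym_kernel P m.
Proof.
move=> asymP m.
case: irrP => _ /(_ (Subbiact (@sym_kernel_closed _ _ P)))[/= P00|/= ->] //.
(* Without a right action, the generators of [sym_kernel P] are the values of the left action, so
   its vanishing makes [P] trivial. *)
case: ntP => x p; split=> //.
suff : [set 0] (lact x p + ract p x) by rewrite asymP addr0.
by rewrite -P00; apply: sub_lspan; exists x, p.
Qed.

End FullSubbimodules.

Section TruncatedTensor.
Context {F : fieldType} {L : leibnizType F} {M N : bimodType L}.

(** Pure tensors span the tensor product, so it suffices to test them. *)
Lemma biact_quotient_zero (U : subbiact (biact_tensor M N)) :
  (forall m n, U (tens m n)) -> zero_space (biact_quotient U).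
Proof.
move=> Utens; elim/quotient_ind=> t.
rewrite -(linear0 (quotient_proj U)); apply/quotient_projP; rewrite subr0.
elim/tensor_ind: t => [|a t u Ut Uu|m n]; last exact: Utens.
  exact: subspace0.
exact: subspaceD.
Qed.

Lemma sub_gen_subbiact (P : biactType L) (A : set P) : A `<=` gen_subbiact A.
Proof. exact: sub_gen_smallest. Qed.

(** Symmetry of [M] kills [lact x m + ract m x], hence the first summand of each element of
    [truncT_gen]; the second is a tensor of generators of the two spans. *)
Lemma truncT_ract_image_sym_kernel : symmetric_bimod M ->
  forall m n, ract_image M m -> sym_kernel N n -> truncT M N (tens m n).
Proof.
move=> symM; apply: lspan_tens => _ _ [m [y ->]] [x [n ->]].
apply: sub_gen_subbiact; exists x, y, m, n.
by rewrite (symM x) subrr (linear_fun0 (tens_linearl _)) add0r.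
Qed.

(** Mirror case: symmetry of [N] kills the second summand and leaves the first. *)
Lemma truncT_sym_kernel_ract_image : symmetric_bimod N ->
  forall m n, sym_kernel M m -> ract_image N n -> truncT M N (tens m n).
Proof.
move=> symN; apply: lspan_tens => _ _ [x [m ->]] [n [y ->]].
apply: sub_gen_subbiact; exists x, y, m, n.
by rewrite (symN x) subrr (linear_fun0 (tens_linearr _)) addr0.
Qed.

Lemma truncT0_ract_image_sym_kernel m n :
  ract_image M m -> sym_kernel N n -> truncT0 M N (tens m n).
Proof.
move=> Mm Nn; exists 0; first exact: subspace0.
exists (tens m n); last by rewrite add0r.
by apply: sub_lspan; exists m, n.
Qed.

Lemma truncT0_sym_kernel_ract_image m n :
  sym_kernel M m -> ract_image N n -> truncT0 M N (tens m n).
Proof.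
move=> Mm Nn; exists (tens m n); first by apply: sub_lspan; exists m, n.
by exists 0; [exact: subspace0|rewrite addr0].
Qed.

End TruncatedTensor.

Theorem corollary4p9 (F : fieldType) (L : leibnizType F) (M N : bimodType L)
    (ntM : ~ trivial_bimod M) (irrM : irreducible_bimod M)
    (ntN : ~ trivial_bimod N) (irrN : irreducible_bimod N) :
  (symmetric_bimod M -> antisymmetric_bimod N ->
     zero_space (tensor_over M N) /\ zero_space (tensor_under M N)) /\
  (antisymmetric_bimod M -> symmetric_bimod N ->
     zero_space (tensor_over M N) /\ zero_space (tensor_under M N)).
Proof.
split=> [symM asymN|asymM symN].
  have ML := symmetric_ract_image ntM irrM symM.
  have N0 := antisymmetric_sym_kernel ntN irrN asymN.
  split; apply: biact_quotient_zero => m n.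
    exact: truncT_ract_image_sym_kernel.
  exact: truncT0_ract_image_sym_kernel.
have M0 := antisymmetric_sym_kernel ntM irrM asymM.
have NL := symmetric_ract_image ntN irrN symN.
split; apply: biact_quotient_zero => m n.
  exact: truncT_sym_kernel_ract_image.
exact: truncT0_sym_kernel_ract_image.
Qed.
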